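(* Let $0\le m\le n$ be integers. If $s(x)$ is a complex polynomial of degree $n-m$, then $$U_n\,s(x)=(1-x)^m\frac{(n-m)!}{n!}\,U_{n-m}\,s(x).$$ Respectively, if $c(x)$ is a complex polynomial of degree $\le n-m$, then $$U_n^{-1}\big((1-x)^mc(x)\big)=\frac{n!}{(n-m)!}\,U_{n-m}^{-1}c(x).$$
   Context: The Euler polynomials $A_k(x)$ are defined by $\frac{A_k(x)}{(1-x)^{k+1}}=\sum_{m\ge0}m^kx^m$, with $A_0=1$. For an integer $N\ge0$, $U_N$ is the linear operator on the space $\mathcal P_N$ of polynomials of degree at most $N$ with $U_N x^p=\frac1{N!}(1-x)^{N-p}A_p(x)$, $p=0,\dots,N$; it is invertible with $U_N^{-1}x^p=(x)_p[x+1]_{N-p}$, where $(\varphi)_k$ and $[\varphi]_k$ are the falling and rising factorials (both $=1$ for $k=0$). *)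

(* Defs.v *)
From HB Require Import structures.
From mathcomp Require Import all_boot all_order all_algebra.
From mathcomp Require Import ring.

Set Implicit Arguments.
Unset Strict Implicit.
Unset Printing Implicit Defensive.

Import Order.TTheory GRing.Theory Num.Theory.
Local Open Scope ring_scope.

Section EulerOperator.
Variable F : numFieldType.
Implicit Types (f : nat -> F) (s : {poly F}).

(* A_k(x) = (1 - x)^(k+1) * sum_(m >= 0) m^k x^m, with 0 ^ 0 = 1. The product
   is computed modulo x^(k+1), to which the terms m > k do not contribute;
   euler_polyP shows that the product has no further nonzero coefficient. *)
Definition euler_poly (k : nat) : {poly F} :=
  take_poly k.+1 ((1 - 'X) ^+ k.+1 * \poly_(m < k.+1) m%:R ^+ k).

Lemma coef_mul_trunc s f M j : (j < M)%N ->
  (s * \poly_(m < M) f m)`_j = \sum_(i < j.+1) s`_i * f (j - i)%N.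
Proof.
move=> jM; rewrite coefM; apply: eq_bigr => i _.
by rewrite coef_poly (leq_ltn_trans (leq_subr _ _) jM).
Qed.

Lemma coef_mul_truncE s f M M' j : (j < M)%N -> (j < M')%N ->
  (s * \poly_(m < M) f m)`_j = (s * \poly_(m < M') f m)`_j.
Proof. by move=> jM jM'; rewrite !coef_mul_trunc. Qed.

Lemma euler_coef_gt k j M : (k < j < M)%N ->
  ((1 - 'X) ^+ k.+1 * \poly_(m < M) (m%:R ^+ k : F))`_j = 0.
Proof.
elim: k j M => [|k IHk] j M /andP[kj jM].
  rewrite expr1 mulrBl mul1r coefB coefXM !coef_poly jM.
  by case: j kj jM => //= j _ /ltnW ->; rewrite !expr0 subrr.
set p := \poly_(m < M) (m%:R ^+ k : F).
have -> : \poly_(m < M) (m%:R ^+ k.+1 : F) = 'X * p^`().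
  apply/polyP=> i; rewrite [LHS]coef_poly coefXM.
  case: i => [|i] /=; first by rewrite exprS mul0r if_same.
  rewrite coef_deriv coef_poly.
  by case: ifP; rewrite ?mul0rn // exprS mulr_natl.
have -> : (1 - 'X) ^+ k.+2 * ('X * p^`()) =
    'X * ((1 - 'X) ^+ k.+2 * p)^`() + 'X * ((1 - 'X) ^+ k.+1 * p) *+ k.+2.
  rewrite derivM deriv_exp derivB derivX -[1]/(1%:P) derivC sub0r.
  rewrite -mulr_natr -[in RHS]mulr_natr; ring.
rewrite coefD coefMn !coefXM; case: j kj jM => //= j kj jM.
have [jM1 kj1] := (ltnW jM, ltnW kj); have {}kj : (k < j)%N by [].
have [IHj IHj1] : ((1 - 'X) ^+ k.+1 * p)`_j = 0 /\ ((1 - 'X) ^+ k.+1 * p)`_j.+1 = 0.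
  by rewrite !IHk ?kj ?kj1.
rewrite IHj mul0rn addr0 coef_deriv.
by rewrite exprS -mulrA mulrBl mul1r coefB coefXM /= IHj IHj1 subrr mul0rn.
Qed.

(* The identity A_k(x) / (1 - x)^(k+1) = sum_m m^k x^m of formal power series,
   read modulo x^M for every M. *)
Lemma euler_polyP k M :
  take_poly M (euler_poly k) =
  take_poly M ((1 - 'X) ^+ k.+1 * \poly_(m < M) m%:R ^+ k).
Proof.
apply/polyP=> j; rewrite !coef_take_poly; case: ifP => // jM.
case: ltnP => jk; first exact: coef_mul_truncE.
by rewrite euler_coef_gt ?jk.
Qed.

Lemma size_euler_poly k : (size (euler_poly k) <= k.+1)%N.
Proof. exact: size_take_poly. Qed.

(* The linear extension of x^p |-> (1 - x)^(N-p) A_p(x) / N! to {poly_N.+1 F},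
   the space of polynomials of degree at most N. Here and below npolyp k s is s
   itself, viewed in {poly_k F}, as soon as size s <= k; by U_val nothing is cut
   off here. *)
Definition Uimage (N : nat) (s : {poly_N.+1 F}) : {poly_N.+1 F} :=
  npolyp N.+1
    (\sum_(p < N.+1) s`_p *: (N`!%:R^-1 *: ((1 - 'X) ^+ (N - p) * euler_poly p))).

Fact Uimage_is_linear N : linear (@Uimage N).
Proof.
move=> a s t; set B := fun p => N`!%:R^-1 *: ((1 - 'X) ^+ (N - p) * euler_poly p).
have E : \sum_(p < N.+1) (a *: s + t : {poly F})`_p *: B p =
    a *: (\sum_(p < N.+1) s`_p *: B p) + \sum_(p < N.+1) t`_p *: B p.
  rewrite scaler_sumr -big_split; apply: eq_bigr => p _ /=.
  by rewrite coefD coefZ scalerDl scalerA.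
apply/val_inj/polyP => j; rewrite [val _]/= coefD coefZ !coef_npolyp.
by case: ifP => _; rewrite ?mulr0 ?addr0 // -coefZ -coefD -E.
Qed.
HB.instance Definition _ N :=
  GRing.isLinear.Build F {poly_N.+1 F} {poly_N.+1 F} _ (@Uimage N)
    (@Uimage_is_linear N).

Definition U (N : nat) : 'End({poly_N.+1 F}) := linfun (@Uimage N).

(* A two-sided inverse, since U_N is bijective; see lker0_U, UK and UinvK. *)
Definition Uinv (N : nat) : 'End({poly_N.+1 F}) := (U N)^-1%VF.

Lemma size_Umon N p : (p <= N)%N ->
  (size ((1 - 'X) ^+ (N - p) * euler_poly p : {poly F})%R <= N.+1)%N.
Proof.
move=> pN; apply: leq_trans (size_polyMleq _ _) _.
have h1 : (size ((1 - 'X : {poly F}) ^+ (N - p))%R <= (N - p).+1)%N.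
  apply: leq_trans (size_poly_exp_leq _ _) _.
  by rewrite -opprB size_polyN size_XsubC mul1n.
rewrite -subn1; apply: leq_trans (leq_sub2r 1 (leq_add h1 (size_euler_poly p))) _.
by rewrite addSn addnS subn1 /= subnK.
Qed.

Lemma U_val N (s : {poly_N.+1 F}) :
  U N s = \sum_(p < N.+1)
    s`_p *: (N`!%:R^-1 *: ((1 - 'X) ^+ (N - p) * euler_poly p)) :> {poly F}.
Proof.
rewrite lfunE /= npolypK //; apply: leq_trans (size_sum _ _ _) _.
apply/bigmax_leqP => p _; rewrite scalerA (leq_trans (size_scale_leq _ _)) //.
by rewrite size_Umon // -ltnS.
Qed.

Lemma U_Xn N p : (p <= N)%N ->
  U N (npolyp N.+1 'X^p) = N`!%:R^-1 *: ((1 - 'X) ^+ (N - p) * euler_poly p)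
  :> {poly F}.
Proof.
move=> pN; have pN1 : (p < N.+1)%N by [].
rewrite U_val (bigD1 (Ordinal pN1)) //= big1 => [|i ip].
  by rewrite coef_npolyp pN1 coefXn eqxx scale1r addr0.
rewrite coef_npolyp ltn_ord coefXn; case: eqP => [e|]; last by rewrite scale0r.
by rewrite -val_eqE /= e eqxx in ip.
Qed.

(* U_N s = (1 - x)^(N+1) / N! * sum_m s(m) x^m modulo x^M *)
Lemma U_series N (s : {poly_N.+1 F}) M :
  take_poly M (U N s) =
  take_poly M (N`!%:R^-1 *: ((1 - 'X) ^+ N.+1 * \poly_(m < M) s.[m%:R])).
Proof.
have -> : \poly_(m < M) s.[m%:R] =
    \sum_(p < N.+1) s`_p *: \poly_(m < M) (m%:R ^+ p : F).
  apply/polyP=> m; rewrite coef_sum coef_poly.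
  under eq_bigr do rewrite coefZ coef_poly.
  case: ifP => _; last by rewrite big1 // => i _; rewrite mulr0.
  by rewrite (horner_coef_wide _ (size_npoly s)).
rewrite U_val take_poly_sum mulr_sumr scaler_sumr take_poly_sum.
apply: eq_bigr => p _; rewrite -scalerAr !take_polyZ !scalerA.
rewrite [in RHS]mulrC; congr (_ *: _).
have [q pN] : {q : nat | (q <= N)%N & q = p} by exists (p : nat); rewrite // -ltnS.
move=> <-; rewrite -[in RHS](subnK pN) -addnS exprD -mulrA.
apply/polyP=> j; rewrite !coef_take_poly.
case: ifP => // jM; rewrite !coefM; apply: eq_bigr => i _; congr (_ * _).
have := congr1 (fun q : {poly F} => q`_(j - i)) (euler_polyP q M).
by rewrite !coef_take_poly (leq_ltn_trans (leq_subr _ _) jM).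
Qed.

Definition falling (phi : {poly F}) (k : nat) : {poly F} :=
  \prod_(i < k) (phi - i%:R).
Definition rising (phi : {poly F}) (k : nat) : {poly F} :=
  \prod_(i < k) (phi + i%:R).

Lemma ffactD n a b : (n ^_ (a + b) = n ^_ a * (n - a) ^_ b)%N.
Proof.
by elim: b => [|b IHb]; rewrite ?addn0 ?muln1 // addnS !ffactnSr IHb -mulnA subnDA.
Qed.

Lemma horner_monomial N p m : (p <= N)%N ->
  (falling 'X p * rising ('X + 1) (N - p)).[m%:R] =
  (N`! * 'C(m + N - p, N))%:R :> F.
Proof.
move=> pN.
have fallE k : (falling 'X k).[m%:R] = (m ^_ k)%:R :> F.
  elim: k => [|k IHk]; first by rewrite /falling big_ord0 hornerE.
  rewrite /falling big_ord_recr /= -/(falling _ k) hornerM IHk ffactnSr natrM.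
  rewrite !hornerE -polyC_natr hornerC.
  case: (leqP k m) => [km|mk]; first by rewrite natrB.
  by rewrite ffact_small // !mul0r.
have riseE k : (rising ('X + 1) k).[m%:R] = ((m + k) ^_ k)%:R :> F.
  elim: k => [|k IHk]; first by rewrite /rising big_ord0 hornerE.
  rewrite /rising big_ord_recr /= -/(rising _ k) hornerM IHk addnS ffactSS natrM.
  by rewrite !hornerE -polyC_natr hornerC -addnS natrD -natr1 addrAC addrA mulrC.
rewrite hornerM fallE riseE -natrM -addnBA // [(N`! * _)%N]mulnC bin_ffact.
by rewrite -{4}(subnK pN) ffactD addnK mulnC.
Qed.

Lemma binomial_series N M :
  take_poly M ((1 - 'X) ^+ N.+1 * \poly_(m < M) ('C(m + N, N)%:R : F)) =
  take_poly M 1.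
Proof.
elim: N => [|N IHN].
  apply/polyP=> j; rewrite !coef_take_poly; case: ifP => // jM.
  rewrite expr1 mulrBl mul1r coefB coefXM !coef_poly coef1 jM bin0.
  by case: j jM => [|j] jM /=; rewrite ?subr0 // (ltnW jM) bin0 subrr.
rewrite -IHN exprSr -mulrA; apply/polyP=> j; rewrite !coef_take_poly.
case: ifP => // jM; rewrite !coefM; apply: eq_bigr => i _; congr (_ * _).
have : (j - i < M)%N by exact: leq_ltn_trans (leq_subr _ _) jM.
move: (j - i)%N => k kM; rewrite mulrBl mul1r coefB coefXM !coef_poly kM.
case: k kM => [|k] kM /=; first by rewrite !add0n !binn subr0.
by rewrite (ltnW kM) !addSn binS !addnS natrD addrAC subrr add0r.
Qed.

Lemma size_monomial N p : (p <= N)%N ->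
  (size (falling 'X p * rising ('X + 1) (N - p))%R <= N.+1)%N.
Proof.
move=> pN; rewrite /falling /rising.
have -> : \prod_(i < p) ('X - i%:R) = \prod_(i < p) ('X - (i%:R)%:P) :> {poly F}.
  by apply: eq_bigr => i _; rewrite polyC_natr.
have -> : \prod_(i < N - p) ('X + 1 + i%:R) =
    \prod_(i < N - p) ('X - (- i.+1%:R)%:P) :> {poly F}.
  by apply: eq_bigr => i _; rewrite polyCN opprK polyC_natr -addrA nat1r.
apply: leq_trans (size_polyMleq _ _) _.
have size_ord k : size (index_enum 'I_k) = k.
  by rewrite -[RHS]card_ord cardT enumT [index_enum _]unlock.
by rewrite !size_prod_XsubC !size_ord addSn addnS /= subnKC.
Qed.

Lemma U_monomial N p : (p <= N)%N ->
  U N (npolyp N.+1 (falling 'X p * rising ('X + 1) (N - p))) =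
  npolyp N.+1 'X^p.
Proof.
move=> pN; apply/val_inj; rewrite [val (npolyp _ _)]npolypK ?size_polyXn //.
rewrite -[LHS](take_poly_id (size_npoly _)) U_series npolypK ?size_monomial //.
have -> : \poly_(m < N.+1) (falling 'X p * rising ('X + 1) (N - p)).[m%:R] =
    N`!%:R *: \poly_(m < N.+1) 'C(m + N - p, N)%:R :> {poly F}.
  apply/polyP => m; rewrite coefZ !coef_poly; case: ifP => _; last by rewrite mulr0.
  by rewrite horner_monomial // natrM.
rewrite -scalerAr scalerA mulVf ?scale1r; last by rewrite pnatr_eq0 -lt0n fact_gt0.
apply/polyP => j; rewrite coef_take_poly coefXn; case: ltnP => jN; last first.
  by case: eqP jN => // ->; rewrite ltnNge pN.
pose P := \poly_(m < N.+1) ('C(m + N, N)%:R : F).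
transitivity (('X^p * ((1 - 'X) ^+ N.+1 * P))`_j).
  rewrite mulrCA !coefM; apply: eq_bigr => i _; congr (_ * _).
  have : (j - i < N.+1)%N by exact: leq_ltn_trans (leq_subr _ _) jN.
  move: (j - i)%N => k kN; rewrite coefXnM !coef_poly kN.
  case: ltnP => pk; first by rewrite bin_small // -addnBA // -[X in (_ < X)%N](subnKC pN) ltn_add2r.
  by rewrite (leq_ltn_trans (leq_subr _ _) kN) addnBAC.
rewrite coefXnM; case: ltnP => pj; first by rewrite (ltn_eqF pj).
have := congr1 (fun q : {poly F} => q`_(j - p)) (binomial_series N N.+1).
rewrite !coef_take_poly (leq_ltn_trans (leq_subr _ _) jN) => ->.
by rewrite coef1 subn_eq0 eqn_leq pj andbT.
Qed.

Lemma lker0_U N : lker (U N) == 0%VS.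
Proof.
have U_onto : limg (U N) = fullv.
  apply/eqP; rewrite eqEsubv subvf.
  rewrite -[X in (X <= _)%VS](span_basis (npolyX_full F N.+1)).
  apply/span_subvP => v /tnthP[p ->]; have pN : (p <= N)%N by rewrite -ltnS.
  suff -> : tnth (npolyX F N.+1) p = npolyp N.+1 'X^p.
    by rewrite -(U_monomial pN) memv_img ?memvf.
  by rewrite tnth_map tnth_ord_tuple.
rewrite -dimv_eq0 -(eqn_add2r (\dim (limg (U N)))) add0n.
by rewrite -[X in (\dim X + _)%N]capfv limg_ker_dim U_onto.
Qed.

Lemma UK N : cancel (U N) (Uinv N).
Proof. exact: lker0_lfunK (lker0_U N). Qed.

Lemma UinvK N : cancel (Uinv N) (U N).
Proof. exact: lker0_lfunVK (lker0_U N). Qed.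

Lemma Uinv_Xn N p : (p <= N)%N ->
  Uinv N (npolyp N.+1 'X^p) = falling 'X p * rising ('X + 1) (N - p) :> {poly F}.
Proof. by move=> pN; rewrite -U_monomial // UK npolypK // size_monomial. Qed.

End EulerOperator.

Arguments U {F} N.
Arguments Uinv {F} N.

(* Main.v *)
Require Import Defs.
From mathcomp Require Import all_boot all_order all_algebra reals.
From mathcomp.real_closed Require Import complex.
Import GRing.Theory.
Local Open Scope ring_scope.
Local Open Scope complex_scope.

(** Put [k = n - m]. For [p <= k] the images of x^p under U_(m+k) and U_k are multiples of
    (1-x)^(m+k-p) A_p and (1-x)^(k-p) A_p with the same A_p, so they differ only by (1-x)^m and
    k!/(m+k)!; linearity gives [U_addn]. It covers every degree up to [k], as [Uinv_addn] applies it
    to U_k^(-1) c, and inverting U_(m+k) there gives the second formula. *)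

Lemma U_addn (F : numFieldType) (m k : nat) (s : {poly F}) :
  (size s <= k.+1)%N ->
  U (m + k) (npolyp (m + k).+1 s) =
    (1 - 'X) ^+ m * ((k`!%:R / (m + k)`!%:R) *: U k (npolyp k.+1 s)) :> {poly F}.
Proof.
move=> sk; have kmk : (k.+1 <= (m + k).+1)%N by rewrite ltnS leq_addl.
rewrite [polyn (_ *: _)]/= !U_val !npolypK ?(leq_trans sk) // scaler_sumr mulr_sumr.
(* Extend the sum for U_k to the index range of U_(m+k): the added terms have [p > k], where the
   coefficient of [s] is 0. *)
rewrite (big_ord_widen _ (fun p => (1 - 'X) ^+ m * (_ *: (s`_p *: (_ *:
  ((1 - 'X) ^+ (k - p) * euler_poly F p))))) kmk).
rewrite [RHS]big_mkcond; apply: eq_bigr => p _ /=.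
case: ltnP => [pk|kp]; last by rewrite nth_default ?scale0r // (leq_trans sk).
have k0 : k`!%:R != 0 :> F by rewrite Num.Theory.pnatr_eq0 -lt0n fact_gt0.
rewrite -addnBA // exprD -mulrA -!scalerAr !scalerA; congr (_ *: _).
by rewrite [RHS]mulrC -!mulrA mulKf // mulrC.
Qed.

(** Since U_(m+k) is injective, it suffices that it sends [a *: t], the claimed preimage, to (1-x)^m
    c. *)
Lemma Uinv_addn (F : numFieldType) (m k : nat) (c : {poly F}) :
  (size c <= k.+1)%N ->
  Uinv (m + k) (npolyp (m + k).+1 ((1 - 'X) ^+ m * c)) =
    ((m + k)`!%:R / k`!%:R) *: Uinv k (npolyp k.+1 c) :> {poly F}.
Proof.
move=> ck; set t := Uinv k _.
have tk : (size t <= k.+1)%N by rewrite size_npoly.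
have tmk : (size t <= (m + k).+1)%N by rewrite (leq_trans tk) // ltnS leq_addl.
have fact0 j : j`!%:R != 0 :> F by rewrite Num.Theory.pnatr_eq0 -lt0n fact_gt0.
set a := _ / _.
suff -> : npolyp (m + k).+1 ((1 - 'X) ^+ m * c) =
    U (m + k) (a *: npolyp (m + k).+1 t).
  by rewrite UK /= npolypK.
have Ut : U (m + k) (npolyp (m + k).+1 t) = (1 - 'X) ^+ m * (a^-1 *: c) :> {poly F}.
  rewrite U_addn // invf_div.
  have -> : npolyp k.+1 t = t.
    by apply/val_inj; rewrite [LHS]npolypK.
  by rewrite /t UinvK [polyn (_ *: _)]/= npolypK.
(* As a value of U_(m+k), the product has degree at most [m + k], so [npolyp] truncates nothing. *)
have E : (1 - 'X) ^+ m * c = (U (m + k) (a *: npolyp (m + k).+1 t) : {poly F}).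
  by rewrite linearZ /= Ut -scalerAr scalerA mulfV ?scale1r // mulf_neq0 ?invr_neq0.
by apply/val_inj; rewrite E [LHS]npolypK // size_npoly.
Qed.

Theorem theorem10 (R : realType) (m n : nat) (hmn : (m <= n)%N) :
  (forall s : {poly R[i]}, size s = (n - m).+1 ->
     U n (npolyp n.+1 s) =
       (1 - 'X) ^+ m *
         (((n - m)`!%:R / n`!%:R) *: U (n - m) (npolyp (n - m).+1 s))
       :> {poly R[i]})
  /\
  (forall c : {poly R[i]}, (size c <= (n - m).+1)%N ->
     Uinv n (npolyp n.+1 ((1 - 'X) ^+ m * c)) =
       (n`!%:R / (n - m)`!%:R) *: Uinv (n - m) (npolyp (n - m).+1 c)
       :> {poly R[i]}).
Proof.
(* Writing n as [m + k] removes truncated subtraction. *)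
rewrite -(subnKC hmn); move: (n - m)%N => k; rewrite addKn.
split=> [s ks|c ck]; last exact: Uinv_addn.
by apply: U_addn; rewrite ks.
Qed.
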